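(* Let $K\ge 1$ and $T\ge 1$ be integers, and consider any stochastic one-sided full-information bandit with $K$ arms and rewards in $[0,1]$. The (pseudo-)regret over $T$ rounds of the elimination algorithm ELIM run with known time horizon $T$ satisfies $$\mathbb{E}\Big[\sum_{t=1}^T \big(X^{(t)}_{i^*}-X^{(t)}_{I_t}\big)\Big]\;\le\; 4\sqrt{2T\ln(KT^2)}+3 .$$
   Context: One-sided full-information bandit: there are $K$ arms $[K]=\{1,\dots,K\}$ and an unknown distribution $\nu$ on $[0,1]^K$ (coordinates may be correlated). In each round $t=1,2,\dots$ a reward vector $X^{(t)}=(X^{(t)}_1,\dots,X^{(t)}_K)$ is drawn from $\nu$, independently across rounds. The player chooses an arm $I_t$ (based on past observations), gains $X^{(t)}_{I_t}$, and observes $X^{(t)}_i$ for all $i\ge I_t$. Write $\mu_i=\mathbb{E}[X^{(t)}_i]$ and let $i^*$ be a best arm, i.e. $\mu_{i^*}\ge\mu_i$ for all $i\in[K]$. The pseudo-regret (called regret) over $T$ rounds is $\mathbb{E}[\sum_{t=1}^T (X^{(t)}_{i^*}-X^{(t)}_{I_t})]$ (equivalently $\mathbb{E}[\sum_{t=1}^T(\mu_{i^*}-\mu_{I_t})]$). Algorithm ELIM with time horizon $T$: set $S_0=[K]$ and $\hat\mu_{i,0}=0$ for all $i$. Let $\rho_1=\infty$ and $\rho_t=\sqrt{\frac{\ln(KT^2)}{2(t-1)}}$ for $t\ge 2$. For $t=1,\dots,T$: (1) let $m_{t-1}\in\arg\max_{i\in S_{t-1}}\hat\mu_{i,t-1}$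 (ties broken arbitrarily); (2) let $S_t=\{i\in S_{t-1}: \hat\mu_{m_{t-1},t-1}-\hat\mu_{i,t-1}\le 2\rho_t\}$; (3) play $I_t=\min S_t$ and observe $X_i^{(t)}$ for all $i\ge I_t$; (4) for all $i\in S_t$ set $\hat\mu_{i,t}=\hat\mu_{i,t-1}\cdot\frac{t-1}{t}+X_i^{(t)}\cdot\frac1t$ (so $\hat\mu_{i,t}=\frac1t\sum_{s=1}^t X_i^{(s)}$ for $i\in S_t$). *)

(* Defs.v *)
From HB Require Import structures.
From mathcomp Require Import all_boot all_order all_algebra.
From mathcomp Require Import finmap.
From mathcomp Require Import all_classical all_reals all_analysis.

Set Implicit Arguments.
Unset Strict Implicit.
Unset Printing Implicit Defensive.
Import Order.TTheory GRing.Theory Num.Theory.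

Local Open Scope classical_set_scope.
Local Open Scope ring_scope.

(* Reward vectors live in R^K with its product Borel sigma-algebra. Arms are
   the elements of 'I_K, i.e. numbered 0, ..., K.-1 instead of 1, ..., K; only
   their order matters. *)
Notation reward_vector R K := (K.-tuple (measurableTypeR R)).

Definition unit_cube (R : realType) (K : nat) : set (reward_vector R K) :=
  [set x | forall i : 'I_K, 0 <= tnth x i <= 1].

Definition mean_reward (R : realType) (K : nat)
    (nu : probability (reward_vector R K) R) (i : 'I_K) : \bar R :=
  ('E_nu[fun x : reward_vector R K => tnth x i])%E.

Definition best_arm (R : realType) (K : nat)
    (nu : probability (reward_vector R K) R) (istar : 'I_K) : Prop :=
  forall i : 'I_K, (mean_reward nu i <= mean_reward nu istar)%E.

(* Mutual independence of the random variables X i, i in A. *)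
Definition mutually_independent (d d' : measure_display)
    (Omega : measurableType d) (T' : measurableType d') (R : realType)
    (P : probability Omega R) (I : choiceType) (A : set I)
    (X : I -> {RV P >-> T'}) : Prop :=
  forall J : {fset I}, [set` J] `<=` A ->
  forall B : I -> set T', (forall i, measurable (B i)) ->
  P (\bigcap_(i in [set` J]) (X i @^-1` B i)) =
  (\prod_(i <- J) P (X i @^-1` B i))%E.

(* X t is the reward vector of round t = 1, 2, ...; X 0 is unused. *)
Definition stochastic_bandit (d : measure_display) (Omega : measurableType d)
    (R : realType) (P : probability Omega R) (K : nat)
    (nu : probability (reward_vector R K) R)
    (X : nat -> {RV P >-> reward_vector R K}) : Prop :=
  [/\ nu (@unit_cube R K) = 1%E,
      forall t : nat, (1 <= t)%N ->
        forall B : set (reward_vector R K), measurable B ->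
          distribution P (X t) B = nu B
    & mutually_independent [set t : nat | (1 <= t)%N] X].

Definition rho (R : realType) (K T t : nat) : \bar R :=
  if (t <= 1)%N then +oo%E
  else (Num.sqrt (ln (K%:R * T%:R ^+ 2) / (2 * (t.-1)%:R)))%:E.

(* A run of the elimination algorithm with horizon T on the rewards x, where
   x t i is the reward of arm i in round t. The arm m t is any maximiser of
   muhat t over S t, so every way of breaking ties is a run. The estimates are
   only constrained on the surviving arms, all of which are at or above the
   played arm I t, so a run depends on x only through observed rewards. *)
Definition ELIM_run (R : realType) (K T : nat) (x : nat -> 'I_K -> R)
    (S : nat -> {set 'I_K}) (muhat : nat -> 'I_K -> R)
    (m I : nat -> 'I_K) : Prop :=
  [/\ S 0%N = [set: 'I_K]%SET,
      forall i : 'I_K, muhat 0%N i = 0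
    & forall t : nat, (1 <= t <= T)%N ->
      [/\ m t.-1 \in S t.-1 /\
            (forall i, i \in S t.-1 -> muhat t.-1 i <= muhat t.-1 (m t.-1)),
          forall i, i \in S t <->
            i \in S t.-1 /\
            ((muhat t.-1 (m t.-1) - muhat t.-1 i)%:E <= 2%:E * rho R K T t)%E,
          I t \in S t /\ (forall i, i \in S t -> (I t <= i)%N)
        & forall i, i \in S t ->
            muhat t i = muhat t.-1 i * ((t.-1)%:R / t%:R) + x t i * t%:R^-1]].

(* The expectation of a real function on Omega; the arm played may depend on
   the outcome. *)
Definition pseudo_regret (d : measure_display) (Omega : measurableType d)
    (R : realType) (P : probability Omega R) (K T : nat)
    (X : nat -> {RV P >-> reward_vector R K}) (istar : 'I_K)
    (I : Omega -> nat -> 'I_K) : \bar R :=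
  ('E_P[fun w : Omega =>
     (\sum_(1 <= t < T.+1) (tnth (X t w) istar - tnth (X t w) (I w t)))%R])%E.

(* Main.v *)
(* Let A(n, i) be the empirical mean of arm i over the first n rounds and mu i its
   mean. By Hoeffding's inequality and a union bound over n < T and i < K, all
   |A(n, i) - mu i| are at most the confidence radius r(n) = rho_(n+1), except with
   probability at most 2 / T; the failure costs at most T * 2 / T = 2. Otherwise the
   best arm is never eliminated, and the arm played in round n + 1, having survived
   the comparison with it, has gap at most 4 r(n). Round 1 costs at most 1 and the
   sum of 4 r(n) is at most 4 sqrt (2 T ln (K T^2)).
   The arm played in round n + 1 is measurable with respect to the history of the
   first n rounds, hence independent of the rewards of round n + 1, so that its
   expected reward is the expected value of its mean. The selection of maximisers
   need not be measurable, but the surviving sets depend on the rewards alone. *)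
Require Import Defs.
From HB Require Import structures.
From mathcomp Require Import all_boot all_order all_algebra.
From mathcomp Require Import finmap ring lra.
From mathcomp Require Import all_classical all_reals all_analysis.
From mathcomp Require Import measurable_realfun.
Set Implicit Arguments.
Unset Strict Implicit.
Unset Printing Implicit Defensive.
Import Order.TTheory GRing.Theory Num.Theory.
Import numFieldNormedType.Exports.
Local Open Scope classical_set_scope.
Local Open Scope ring_scope.

(** * Hoeffding's exponential inequality for a Bernoulli variable *)

Section hoeffding_lemma.
Context {R : realType}.
Implicit Types (f df : R -> R) (p h : R).

(** Monotonicity on the half-line; applying it twice descends from the sign of a second derivative
    to that of the function. *)
Lemma ge0_from_derive f df : (forall x, is_derive x (1 : R) f (df x)) ->
  f 0 = 0 -> (forall x, 0 <= x -> 0 <= df x) -> forall h, 0 <= h -> 0 <= f h.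
Proof.
move=> fdf f0 df0 h h0; rewrite -f0.
apply: (@ger0_derive1_ndecry R f 0) => //.
- by move=> x; rewrite in_itv/= andbT => /ltW x0; rewrite derive1E derive_val; apply: df0.
- apply: continuous_subspaceT => x.
  by apply/differentiable_continuous/derivable1_diffP.
Qed.

(* The difference of the logarithms of the two sides vanishes at 0 to second order,
   and its second derivative is [1/4 - q (1 - q) >= 0] with [q = p e^h / (1 - p + p e^h)]. *)
Lemma cgf_bernoulli_le p h : 0 <= p <= 1 -> 0 <= h ->
  1 - p + p * expR h <= expR (h * p + h ^+ 2 / 8).
Proof.
move=> /andP[p0 p1] h0.
have pos x : 0 < 1 - p + p * expR x.
  have := expR_gt0 x; have [->|pn0] := eqVneq p 0; first by lra.
  move=> ex; apply: ltr_wpDl; first by lra.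
  by apply: mulr_gt0 => //; lra.
rewrite -[leLHS]lnK ?posrE// ler_expR -subr_ge0.
pose D x := 1 - p + p * expR x.
have dD x : is_derive x (1 : R) D (p * expR x).
  rewrite /D; apply: is_derive_eq; rewrite add0r /GRing.scale/=; ring.
pose df x := p + x / 4 - p * expR x * (D x)^-1.
pose f x := x * p + x ^+ 2 / 8 - ln (D x).
suff : 0 <= f h by [].
apply: (@ge0_from_derive f df _ _ _ h h0).
- move=> x; have dln := is_derive1_ln (pos x).
  have dlnD := @is_derive1_comp _ (@ln R) D _ _ _ dln (dD x).
  apply: is_derive_eq; rewrite /df /GRing.scale/= -/(D x).
  by move: (D x)^-1 => Dx; field.
- by rewrite /f /D expR0 mul0r expr0n/= mul0r mulr1 subrK ln1; ring.
pose ddf x := 4^-1 - (1 - p) * (p * expR x) * (D x) ^- 2.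
move=> y y0; apply: (@ge0_from_derive df ddf _ _ _ y y0).
- move=> x; have Dx0 : D x != 0 by rewrite gt_eqF// pos.
  have dV := is_deriveV Dx0 (dD x).
  apply: is_derive_eq; rewrite /ddf /GRing.scale/=.
  by rewrite /D in Dx0 *; field.
- by rewrite /df /D expR0 mul0r !mulr1 subrK invr1; ring.
move=> x _; rewrite /ddf subr_ge0 ler_pdivrMr ?exprn_gt0//; last exact: pos.
rewrite /D; have := sqr_ge0 (1 - p - p * expR x); lra.
Qed.

(** A negative [h] reduces to the previous case by exchanging [p] with [1 - p] and [h] with [- h],
    then multiplying by [expR h]. *)
Lemma hoeffding_bernoulli p h : 0 <= p <= 1 ->
  1 - p + p * expR h <= expR (h * p + h ^+ 2 / 8).
Proof.
move=> p01; have [h0|/ltW h0] := leP 0 h; first exact: cgf_bernoulli_le.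
have : 1 - (1 - p) + (1 - p) * expR (- h) <= expR (- h * (1 - p) + (- h) ^+ 2 / 8).
  by apply: cgf_bernoulli_le; lra.
rewrite -(ler_pM2l (expR_gt0 h)) -expRD.
rewrite (_ : expR h * _ = 1 - p + p * expR h); last first.
  by rewrite expRN; field; rewrite gt_eqF// expR_gt0.
by rewrite (_ : h + _ = h * p + h ^+ 2 / 8)//; field.
Qed.

(** Convexity of the exponential between the points [0] and [h]. *)
Lemma expR_chord h (x : R) : 0 <= x <= 1 -> expR (h * x) <= 1 - x + x * expR h.
Proof.
move=> /andP[x0 x1]; have := convex_expR (Itv01 x0 x1) h 0.
rewrite !convRE/= /unstable.onem expR0 mulr0 addr0 mulr1 [x * h]mulrC => /le_trans; apply.
by rewrite addrC.
Qed.

End hoeffding_lemma.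

(** * Products of independent non-negative variables *)

Section independence.
Context {R : realType}.
Local Open Scope ereal_scope.

Lemma probability_integral_cst d (T : measurableType d) (P : probability T R) (c : R) :
  \int[P]_w c%:E = c%:E.
Proof. by have := expectation_cst P c; rewrite unlock. Qed.

(** The law of the pair agrees with the product of the two laws on rectangles, hence everywhere;
    Tonelli's theorem then splits the integral. *)
Lemma ge0_integral_indep d d1 d2 (Omega : measurableType d)
    (T1 : measurableType d1) (T2 : measurableType d2) (P : probability Omega R)
    (U : {RV P >-> T1}) (V : {RV P >-> T2}) (f : T1 -> \bar R) (g : T2 -> \bar R) :
  (forall A B, measurable A -> measurable B ->
    P (U @^-1` A `&` V @^-1` B) = P (U @^-1` A) * P (V @^-1` B)) ->
  measurable_fun [set: T1] f -> measurable_fun [set: T2] g ->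
  (forall x, 0 <= f x) -> (forall y, 0 <= g y) ->
  \int[P]_w (f (U w) * g (V w)) = \int[P]_w f (U w) * \int[P]_w g (V w).
Proof.
move=> UV mf mg f0 g0.
pose W w := (U w, V w).
have mW : measurable_fun setT W by exact/measurable_fun_pair.
pose W' : {mfun Omega >-> (T1 * T2)%type} := HB.pack W (isMeasurableFun.Build _ _ _ _ _ mW).
pose h (z : T1 * T2) := f z.1 * g z.2.
have mh : measurable_fun setT h.
  apply: emeasurable_funM; first exact: (measurableT_comp mf measurable_fst).
  exact: (measurableT_comp mg measurable_snd).
have h0 z : 0 <= h z by exact: mule_ge0.
transitivity (\int[distribution P W']_z h z).
  by rewrite ge0_integral_distribution.
rewrite (eq_measure_integral (distribution P U \x distribution P V)); last first.
  move=> A mA _; apply/esym; apply: product_measure_unique => //.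
rewrite fubini_tonelli1//.
under eq_integral => x _.
  rewrite /fubini_F /h/= ge0_integralZl//=.
  over.
rewrite ge0_integralZr//; last by apply: integral_ge0 => y _.
by rewrite !ge0_integral_distribution.
Qed.

End independence.

(** * The sigma-algebra of the first rounds and its independence of the next one *)

Section history.
Context {R : realType} d d' (Omega : measurableType d) (T' : measurableType d')
  (P : probability Omega R) (X : nat -> {RV P >-> T'}).

(* A pi-system generating the sigma-algebra of the rounds 1, ..., n. *)
Definition cylinders (n : nat) : set (set Omega) :=
  [set A | exists2 B : nat -> set T', (forall s, measurable (B s)) &
    A = \bigcap_(s in [set s | (1 <= s <= n)%N]) (X s @^-1` B s)].

Lemma cylinders_measurable n : cylinders n `<=` measurable.
Proof.
move=> _ [B mB ->]; apply: bigcap_measurableType => s _.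
by rewrite -[X in measurable X]setTI; exact: measurable_funP.
Qed.

Lemma history_measurable n A : <<s cylinders n >> A -> measurable A.
Proof.
by apply: smallest_sub; [exact: sigma_algebra_measurable|exact: cylinders_measurable].
Qed.

Lemma cylinders_setI n : setI_closed (cylinders n).
Proof.
move=> _ _ [B mB ->] [C mC ->]; exists (fun s => B s `&` C s).
  by move=> s; exact: measurableI.
by rewrite -bigcapI; apply: eq_bigcapr => s _; rewrite preimage_setI.
Qed.

Lemma cylinders_setT n : cylinders n setT.
Proof.
exists (fun=> setT) => //; by apply/seteqP; split.
Qed.

Lemma cylinders_preimage n s B : (1 <= s <= n)%N -> measurable B ->
  cylinders n (X s @^-1` B).
Proof.
move=> sn mB; exists (fun r => if r == s then B else setT).
  by move=> r; case: ifP.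
apply/seteqP; split => [w wB r _ /=|w /(_ _ sn)/=]; last by rewrite eqxx.
by case: eqP => // ->.
Qed.

(** The space [Omega] with a coarser sigma-algebra, so that dependence on the first [n] rounds only
    becomes plain measurability on this type. *)
Definition history n := g_sigma_algebraType (cylinders n).

Lemma measurable_history n s : (1 <= s <= n)%N ->
  measurable_fun [set: history n] (X s : history n -> T').
Proof.
move=> sn _ B mB; rewrite setTI; apply: sub_sigma_algebra.
exact: cylinders_preimage.
Qed.

Lemma measurable_to_history n : measurable_fun [set: Omega] (idfun : Omega -> history n).
Proof.
by move=> _ B mB; rewrite setTI; apply: history_measurable mB.
Qed.

Hypothesis indep : mutually_independent [set t | (1 <= t)%N] X.

(** As functions of [A], both sides are finite measures. They agree on the pi-system [cylinders n]
    by mutual independence, hence on the sigma-algebra that it generates. *)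
Lemma history_indep n A B : <<s cylinders n >> A -> measurable B ->
  P (A `&` X n.+1 @^-1` B) = (P A * P (X n.+1 @^-1` B))%E.
Proof.
move=> hA mB.
have mXB : measurable (X n.+1 @^-1` B).
  by rewrite -[X in measurable X]setTI; exact: measurable_funP.
have c0 : 0 <= fine (P (X n.+1 @^-1` B)) by exact: fine_ge0.
pose m1 : {measure set Omega -> \bar R} := mrestr P mXB.
pose m2 : {measure set Omega -> \bar R} := mscale (NngNum c0) P.
suff -> : P (A `&` X n.+1 @^-1` B) = m2 A.
  by rewrite /m2/= /mscale/= fineK ?fin_num_measure// muleC.
apply: (g_sigma_algebra_measure_unique (cylinders n) (@cylinders_measurable n)
  (fun=> setT) _ _ m1 m2 _ _ _ A hA).
- by move=> _; exact: cylinders_setT.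
- by rewrite bigcup_const.
- exact: cylinders_setI.
- move=> _ [C mC ->]; rewrite /m1 /m2/= /mscale/mrestr/= fineK ?fin_num_measure//.
  pose J := [fset s in iota 1 n]%fset.
  have JE : [set` J] = [set s | (1 <= s <= n)%N].
    by apply/seteqP; split => s /=; rewrite !inE mem_iota add1n ltnS.
  have nJ : n.+1 \notin J by rewrite !inE mem_iota add1n ltnn andbF.
  (* Putting [B] in round [n.+1] turns the intersection into a single cylinder over [n.+1] rounds,
     to which [indep] applies. *)
  pose C' s := if s == n.+1 then B else C s.
  have C'E s : (s <= n)%N -> C' s = C s.
    by rewrite /C'; case: eqP => // ->; rewrite ltnn.
  have mC' s : measurable (C' s) by rewrite /C'; case: ifP.
  have J1 : [set` (n.+1 |` J)%fset] `<=` [set t | (1 <= t)%N].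
    by move=> s /=; rewrite !inE mem_iota => /orP[/eqP->//|/andP[]].
  have := @indep _ J1 _ mC'.
  rewrite big_fsetU1//= {2}/C' eqxx.
  rewrite (eq_big_seq (fun i => P (X i @^-1` C i))); last first.
    by move=> i; rewrite !inE mem_iota add1n ltnS => /andP[_ /C'E ->].
  rewrite -(@indep J _ C)//; last first.
    by rewrite JE => s /andP[].
  rewrite JE muleC => <-.
  congr (P _); apply/seteqP; split => [w [wC wB] s /=|w wC].
    rewrite !inE mem_iota add1n ltnS /C' => /orP[/eqP->|sn]; first by rewrite eqxx.
    case: eqP => [->//|_]; exact: wC.
  split; last by have := wC n.+1; rewrite /C' eqxx; apply; rewrite /= !inE eqxx.
  move=> s /= sn; have := wC s; rewrite C'E; last by case/andP: sn.
  by apply; rewrite /= !inE mem_iota add1n ltnS sn orbT.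
- move=> _; rewrite /m1/= /mrestr setTI.
  by rewrite ltey_eq fin_num_measure.
Qed.

(** The past is a single random variable, the identity map into [history X n], so the product rule
    for two independent variables applies. *)
Lemma ge0_integral_history n (f : Omega -> \bar R) (g : T' -> \bar R) :
  measurable_fun [set: history n] (f : history n -> \bar R) ->
  measurable_fun [set: T'] g -> (forall w, 0 <= f w)%E -> (forall y, 0 <= g y)%E ->
  (\int[P]_w (f w * g (X n.+1 w)) = \int[P]_w f w * \int[P]_w g (X n.+1 w))%E.
Proof.
move=> mf mg f0 g0.
pose U : {RV P >-> history n} := HB.pack (idfun : Omega -> history n)
  (isMeasurableFun.Build _ _ _ _ _ (@measurable_to_history n)).
apply: (@ge0_integral_indep R _ _ _ _ _ _ P U (X n.+1)) => // A B mA mB.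
exact: history_indep.
Qed.

End history.

(** * Hoeffding's inequality for empirical means *)

Section hoeffding.
Context {R : realType} d d' (Omega : measurableType d) (T' : measurableType d')
  (P : probability Omega R) (nu : probability T' R) (X : nat -> {RV P >-> T'}).
Hypothesis indep : mutually_independent [set t | (1 <= t)%N] X.
Hypothesis distr : forall t, (1 <= t)%N ->
  forall B, measurable B -> distribution P (X t) B = nu B.
Implicit Types phi : T' -> R.

Lemma ge0_integral_identically t (g : T' -> \bar R) : (1 <= t)%N ->
  measurable_fun [set: T'] g -> (forall y, 0 <= g y)%E ->
  (\int[P]_w g (X t w) = \int[nu]_y g y)%E.
Proof.
move=> t1 mg g0; rewrite -(ge0_integral_distribution (X t) mg g0).
by apply: eq_measure_integral => A mA _; exact: distr.
Qed.

Section bounded.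
Variables (phi : T' -> R) (mu : R).
Hypothesis mphi : measurable_fun [set: T'] phi.
Hypothesis phi01 : forall y, 0 <= phi y <= 1.
Hypothesis phimu : (\int[nu]_y (phi y)%:E = mu%:E)%E.

Let phi_ge0 y : (0 <= (phi y)%:E)%E.
Proof. by rewrite lee_fin; case/andP: (phi01 y). Qed.

Let mphiE : measurable_fun [set: T'] (EFin \o phi).
Proof. exact/measurable_EFinP. Qed.

Lemma mean01 : 0 <= mu <= 1.
Proof.
rewrite -!lee_fin -phimu integral_ge0//=.
rewrite -[leRHS](probability_integral_cst nu).
by apply: ge0_le_integral => //= y _; rewrite lee_fin; case/andP: (phi01 y).
Qed.

(** The chord bound is affine in [phi], so integrating it leaves only the mean: among variables in
    the unit interval with mean [mu], the Bernoulli variable is extremal. *)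
Lemma mgf_le (h : R) :
  (\int[nu]_y (expR (h * (phi y - mu)))%:E <= (expR (h ^+ 2 / 8))%:E)%E.
Proof.
have int1 : nu.-integrable [set: T'] (EFin \o phi).
  apply/integrableP; split => //.
  rewrite (eq_integral (EFin \o phi)); first by rewrite phimu ltry.
  by move=> y _; rewrite gee0_abs// phi_ge0.
have intc c : nu.-integrable [set: T'] (EFin \o (cst c : T' -> R)).
  exact: finite_measure_integrable_cst.
(* The chord bound, arranged as a constant plus a multiple of [phi y] for linearity of the
   integral. *)
pose F y := expR (- (h * mu)) * (1 + (expR h - 1) * phi y).
have FE y : F y = expR (- (h * mu)) * (1 - phi y + phi y * expR h).
  by rewrite /F; congr (_ * _); ring.
have le_F y : expR (h * (phi y - mu)) <= F y.
  rewrite FE mulrBr addrC expRD ler_wpM2l ?expR_ge0//.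
  exact: expR_chord.
have mF : measurable_fun [set: T'] F.
  apply: measurable_funM => //; apply: measurable_funD => //.
  exact: measurable_funM.
have : (\int[nu]_y (expR (h * (phi y - mu)))%:E <= \int[nu]_y (F y)%:E)%E.
  apply: ge0_le_integral => //=.
  - apply/measurable_EFinP; apply: measurableT_comp => //.
    by apply: measurable_funM => //; exact: measurable_funB.
  - exact/measurable_EFinP.
  - by move=> y _; rewrite lee_fin.
move=> /le_trans; apply.
rewrite (_ : \int[nu]_y _ = (expR (- (h * mu)) * (1 + (expR h - 1) * mu))%:E)%E.
  rewrite lee_fin (_ : 1 + _ = 1 - mu + mu * expR h); last by ring.
  apply: (@le_trans _ _ (expR (- (h * mu)) * expR (h * mu + h ^+ 2 / 8))).
    by rewrite ler_wpM2l ?expR_ge0//; apply: hoeffding_bernoulli; exact: mean01.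
  by rewrite -expRD addKr.
under eq_integral do rewrite EFinM.
rewrite integralZl//=; last first.
  apply: (@integrableD _ _ _ nu _ measurableT (EFin \o cst 1)
    (fun y => ((expR h - 1) * phi y)%:E)) => //.
  exact: (@integrableZl _ _ _ nu _ _ (expR h - 1) _ int1).
rewrite EFinM; congr (_ * _)%E.
rewrite (integralD measurableT (intc 1) (@integrableZl _ _ _ nu _ measurableT (expR h - 1) _ int1)).
by rewrite integralZl//= phimu probability_integral_cst.
Qed.

Definition centered_sum n w := \sum_(1 <= s < n.+1) (phi (X s w) - mu).

Let measurable_summand d0 (O : measurableType d0) (Y : O -> T') :
  measurable_fun [set: O] Y -> measurable_fun [set: O] (fun w => phi (Y w) - mu).
Proof.
by move=> mY; apply: measurable_funB => //; exact: (measurableT_comp mphi mY).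
Qed.

Lemma measurable_centered_sum n :
  measurable_fun [set: history X n] (centered_sum n : history X n -> R).
Proof.
rewrite /centered_sum.
under eq_fun do rewrite big_add1 big_mkord.
apply: measurable_sum => i; apply: measurable_summand.
by apply: measurable_history; rewrite /= ltn_ord.
Qed.

Lemma measurable_centered_sum_ge n (c : R) : measurable [set w | c <= centered_sum n w].
Proof.
have mS := measurableT_comp (@measurable_centered_sum n)
  (@measurable_to_history _ _ _ _ _ P X n).
have := @measurable_fun_le _ _ _ _ _ _ measurableT (@measurable_cst _ _ _ _ _ c) mS.
by rewrite setTI.
Qed.

(** By induction, the factor of round [n.+1] is split off as independent of the history and bounded
    by [mgf_le]. *)
Lemma centered_sum_mgf n (h : R) :
  (\int[P]_w (expR (h * centered_sum n w))%:E <= (expR (n%:R * (h ^+ 2 / 8)))%:E)%E.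
Proof.
elim: n => [|n IH].
  rewrite /centered_sum; under eq_integral do rewrite big_nil mulr0 expR0.
  by rewrite probability_integral_cst mul0r expR0.
under eq_integral.
  move=> w _; rewrite /centered_sum big_nat_recr//= mulrDr expRD EFinM -/(centered_sum n w).
  over.
rewrite (@ge0_integral_history _ _ _ _ _ _ _ indep n
  (fun w => (expR (h * centered_sum n w))%:E)
  (fun y => (expR (h * (phi y - mu)))%:E)); last 4 first.
- apply/measurable_EFinP; apply: measurableT_comp => //.
  by apply: measurable_funM => //; exact: measurable_centered_sum.
- apply/measurable_EFinP; apply: measurableT_comp => //.
  by apply: measurable_funM => //; exact: measurable_funB.
- by move=> w; rewrite lee_fin expR_ge0.
- by move=> w; rewrite lee_fin expR_ge0.
rewrite (@ge0_integral_identically n.+1 (fun y => (expR (h * (phi y - mu)))%:E)) //; last first.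
  apply/measurable_EFinP; apply: measurableT_comp => //.
  by apply: measurable_funM => //; exact: measurable_funB.
rewrite -natr1 mulrDl mul1r expRD EFinM.
by apply: lee_pmul => //; [apply: integral_ge0 => w _; rewrite lee_fin expR_ge0..|exact: mgf_le].
Qed.

Lemma upper_tail n (a : R) : (0 < n)%N -> 0 <= a ->
  (P [set w | n%:R * a <= centered_sum n w]%R <= (expR (- (2 * n%:R * a ^+ 2)))%:E)%E.
Proof.
(* For [a = 0] the bound is [1]; the Chernoff parameter used below must be positive. *)
move=> n0; rewrite le_eqVlt => /predU1P[<-|a0].
  by rewrite expr0n/= !mulr0 oppr0 expR0; exact/probability_le1/measurable_centered_sum_ge.
have mS : measurable_fun [set: Omega] (centered_sum n).
  exact: (measurableT_comp (@measurable_centered_sum n) (@measurable_to_history _ _ _ _ _ _ X n)).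
pose S : {RV P >-> R} := HB.pack (centered_sum n) (isMeasurableFun.Build _ _ _ _ _ mS).
(* [4 * a] minimises the Chernoff exponent [- h * n * a + n * h ^+ 2 / 8] over [h]. *)
have a4 : 0 < 4 * a by rewrite mulr_gt0.
have := @chernoff _ _ _ P S (4 * a) (n%:R * a) a4.
move=> /le_trans; apply.
rewrite /mmt_gen_fun unlock.
under eq_integral do rewrite /= mulrC.
apply: (@le_trans _ _ ((expR (n%:R * ((4 * a) ^+ 2 / 8)))%:E *
    (expR (- (4 * a * (n%:R * a))))%:E)%E).
  by apply: lee_wpmul2r; [rewrite lee_fin expR_ge0|exact: centered_sum_mgf].
rewrite -EFinM -expRD lee_fin ler_expR.
by rewrite le_eqVlt; apply/orP; left; apply/eqP; field.
Qed.

End bounded.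

Lemma centered_sumE phi mu n w :
  centered_sum phi mu n w = \sum_(1 <= s < n.+1) phi (X s w) - n%:R * mu.
Proof. by rewrite /centered_sum sumrB sumr_const_nat subn1 mulr_natl. Qed.

Definition empirical_mean phi n w := (\sum_(1 <= s < n.+1) phi (X s w)) / n%:R.

Lemma measurable_empirical_mean phi n m : measurable_fun [set: T'] phi ->
  (n <= m)%N -> measurable_fun [set: history X m] (empirical_mean phi n : history X m -> R).
Proof.
move=> mphi nm; rewrite /empirical_mean.
under eq_fun do rewrite big_add1 big_mkord.
apply: measurable_funM => //; apply: measurable_sum => i.
apply: (measurableT_comp mphi).
by apply: measurable_history; rewrite /= (leq_trans _ nm).
Qed.

Lemma measurable_deviation phi mu n (a : R) : measurable_fun [set: T'] phi ->
  measurable [set w | a < `|empirical_mean phi n w - mu|].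
Proof.
move=> mphi; have mE := measurableT_comp (@measurable_empirical_mean phi n n mphi (leqnn n))
  (@measurable_to_history _ _ _ _ _ P X n).
have mD : measurable_fun [set: Omega] (fun w => `|empirical_mean phi n w - mu|).
  by apply: measurableT_comp => //; apply: measurable_funB.
have := @emeasurable_fun_o_infty _ _ _ _ _ measurableT (proj2 (measurable_EFinP _ _) mD) a%:E.
by rewrite setTI.
Qed.

Lemma hoeffding phi mu n (a : R) :
  measurable_fun [set: T'] phi -> (forall y, 0 <= phi y <= 1) ->
  (\int[nu]_y (phi y)%:E = mu%:E)%E -> (0 < n)%N -> 0 <= a ->
  (P [set w | a < `|empirical_mean phi n w - mu|]%R
     <= (2 * expR (- (2 * n%:R * a ^+ 2)))%:E)%E.
Proof.
move=> mphi phi01 phimu n0 a0.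
(* The lower tail of [phi] is the upper tail of [1 - phi]. *)
pose psi y := 1 - phi y.
have mpsi : measurable_fun [set: T'] psi by exact: measurable_funB.
have psi01 y : 0 <= psi y <= 1.
  by have /andP[? ?] := phi01 y; rewrite /psi; apply/andP; split; lra.
have phi1 : nu.-integrable [set: T'] (EFin \o phi).
  apply: measurable_bounded_integrable => //.
    by rewrite ltey_eq fin_num_measure.
  exists 1; split => // M M1 y _ /=; have /andP[p0 p1] := phi01 y.
  by rewrite ger0_norm// (le_trans p1)// ltW.
have psimu : (\int[nu]_y (psi y)%:E = (1 - mu)%:E)%E.
  under eq_integral do rewrite /psi EFinB.
  rewrite (@integralB_EFin _ _ _ _ _ (cst 1) phi)//=; last first.
    exact: finite_measure_integrable_cst.
  by rewrite phimu probability_integral_cst.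
have nR : 0 < n%:R :> R by rewrite ltr0n.
have sub : [set w | a < `|empirical_mean phi n w - mu|] `<=`
    [set w | n%:R * a <= centered_sum phi mu n w] `|`
    [set w | n%:R * a <= centered_sum psi (1 - mu) n w].
  move=> w /=; rewrite !centered_sumE /psi sumrB sumr_const_nat subn1/= /empirical_mean.
  set S := \sum_(_ <= _ < _) _.
  have -> : S = n%:R * (S / n%:R) by rewrite mulrC divfK// gt_eqF.
  rewrite mulrAC mulfV ?gt_eqF// mul1r.
  set e := S / n%:R; rewrite -mulrBr ler_pM2l//.
  rewrite (_ : 1 *+ n - _ - _ = n%:R * (mu - e)); last by ring.
  rewrite ler_pM2l// ltr_normr opprB => /orP[/ltW|/ltW]; first by left.
  by right.
apply: (le_trans (le_measure P _ _ sub)); rewrite ?inE.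
- exact: measurable_deviation.
- by apply: measurableU; exact: measurable_centered_sum_ge.
apply: (le_trans (measureU2 _ _ _)); [exact: measurable_centered_sum_ge..|].
by rewrite mulrDl mul1r EFinD; apply: leeD; exact: upper_tail.
Qed.

End hoeffding.

(** * Pathwise analysis of a run *)

Section elimination.
Context {R : realType} {K T : nat}.

(** Indexed by the number [n] of completed rounds, one less than the index of [rho]. *)
Definition confidence_radius n : R := Num.sqrt (ln (K%:R * T%:R ^+ 2) / (2 * n%:R)).

Definition average (x : nat -> 'I_K -> R) n i : R := (\sum_(1 <= s < n.+1) x s i) / n%:R.

Variables (x : nat -> 'I_K -> R) (S : nat -> {set 'I_K}) (muhat : nat -> 'I_K -> R)
  (m I : nat -> 'I_K).
Hypothesis run : ELIM_run T x S muhat m I.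

Lemma ELIM_decreasing n i : (n < T)%N -> i \in S n.+1 -> i \in S n.
Proof. by case: run => _ _ /(_ n.+1) H nT; case: H => // _ H _ _ /H[]. Qed.

(** A surviving arm has survived every earlier round, so all updates were applied to it, and the
    update is the recursion of running averages. *)
Lemma ELIM_estimate n i : (n <= T)%N -> i \in S n -> muhat n i = average x n i.
Proof.
elim: n => [|n IH] nT iS.
  by case: run => _ -> _; rewrite /average big_geq// mul0r.
case: run => _ _ /(_ n.+1) [//|_ _ _ ->//]; rewrite IH ?(ltnW nT)//=; last first.
  exact: ELIM_decreasing.
rewrite /average [in RHS]big_nat_recr//= mulrDl mulrA; congr (_ / _ + _).
(* For [n = 0] the factor [n] cannot be cancelled, but both sides are [0], the sum being empty. *)
have [->|n0] := posnP n; first by rewrite mulr0 big_geq.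
by rewrite divfK// pnatr_eq0 -lt0n.
Qed.

(** Comparison with a maximiser amounts to comparison with every survivor. This removes [m] and
    [muhat], leaving a recursion for [S] in terms of the rewards alone. *)
Lemma ELIM_survivor n i : (n < T)%N -> reflect
  (i \in S n /\ forall j, j \in S n ->
     ((average x n j - average x n i)%:E <= 2%:E * rho R K T n.+1)%E) (i \in S n.+1).
Proof.
move=> nT; have [_ _ /(_ n.+1)[//|[mS mmax] SE _ _]] := run.
have nT' := ltnW nT; apply: (iffP idP) => [/SE[iS le_i]|[iS le_i]].
  split=> // j jS; apply: le_trans le_i => /=.
  by rewrite -!ELIM_estimate// lee_fin lerB// mmax.
by apply/SE; split=> //=; rewrite !ELIM_estimate//; exact: le_i.
Qed.

Lemma ELIM_played n : (n < T)%N -> I n.+1 \in S n.+1 /\ forall i, i \in S n.+1 -> (I n.+1 <= i)%N.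
Proof. by case: run => _ _ /(_ n.+1) H nT; case: H. Qed.

(** Describes the played arm by memberships in the surviving set, from which its measurability will
    follow. *)
Lemma ELIM_played_eq n i : (n < T)%N ->
  (I n.+1 == i) = (i \in S n.+1) && [forall j : 'I_K, (j < i)%N ==> (j \notin S n.+1)].
Proof.
move=> nT; have [IS Imin] := ELIM_played nT.
apply/eqP/andP => [<-|[iS /forallP imin]].
  split=> //; apply/forallP => j; apply/implyP; apply: contraTN => /Imin.
  by rewrite -leqNgt.
apply/val_inj/eqP; rewrite eqn_leq (Imin i iS)/= leqNgt.
by apply/negP => Ii; have := implyP (imin (I n.+1)) Ii; rewrite IS.
Qed.

Variables (mu : 'I_K -> R) (istar : 'I_K).
Hypothesis istar_best : forall i, mu i <= mu istar.
Hypothesis good : forall n i, (0 < n < T)%N -> `|average x n i - mu i| <= confidence_radius n.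

Lemma rhoE n : (0 < n)%N -> rho R K T n.+1 = (confidence_radius n)%:E.
Proof. by case: n. Qed.

(** The empirical lead of another arm over [istar] exceeds its true lead, which is at most zero, by
    no more than two radii, exactly the tolerance of the algorithm. *)
Lemma ELIM_best_survives n : (n <= T)%N -> istar \in S n.
Proof.
elim: n => [|n IH] nT; first by case: run => -> _ _; rewrite inE.
apply/(ELIM_survivor _ nT); split; first exact/IH/ltnW.
move=> j jS; have [->|n0] := posnP n.
  (* In round 1 the threshold is infinite and nothing is eliminated. *)
  by rewrite /rho/= gt0_muley ?leey// lte_fin.
rewrite rhoE// -EFinM lee_fin.
have := good j (_ : (0 < n < T)%N); have := good istar (_ : (0 < n < T)%N).
rewrite n0 nT => /(_ isT); rewrite ler_norml => /andP[A1 A2] /(_ isT).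
rewrite ler_norml => /andP[B1 B2].
have := istar_best j; lra.
Qed.

(** Two radii come from the comparison with the surviving [istar], one more from the deviation of
    each of the two arms. *)
Lemma ELIM_gap n : (0 < n < T)%N -> mu istar - mu (I n.+1) <= 4 * confidence_radius n.
Proof.
move=> nT; have /andP[n0 nT'] := nT.
have [/(ELIM_survivor _ nT')[_ /(_ istar (ELIM_best_survives (ltnW nT')))] + _] :=
  ELIM_played nT'.
rewrite rhoE// -EFinM lee_fin => H.
have := good (I n.+1) nT; have := good istar nT.
rewrite !ler_norml => /andP[A1 A2] /andP[B1 B2].
lra.
Qed.

End elimination.

(** * Summation of the confidence radii *)

Section radius_sum.
Context {R : realType}.

Lemma sum_sqrt_inv n : \sum_(1 <= k < n.+1) (Num.sqrt k%:R)^-1 <= 2 * Num.sqrt n%:R :> R.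
Proof.
elim: n => [|n IH]; first by rewrite big_geq// sqrtr0 mulr0.
rewrite big_nat_recr//=; apply: (le_trans (lerD IH (lexx _))).
set a := Num.sqrt n%:R; set b := Num.sqrt n.+1%:R.
have b0 : 0 < b by rewrite sqrtr_gt0 ltr0n.
have a2 : a ^+ 2 = n%:R by rewrite sqr_sqrtr.
have b2 : b ^+ 2 = n.+1%:R by rewrite sqr_sqrtr.
(* After multiplication by [b] the claim is [2 a b + 1 <= 2 b^2], which is [(a - b)^2 >= 0] because
   [b^2 = a^2 + 1]. *)
rewrite -(ler_pM2r b0) mulrDl mulVf ?gt_eqF// -mulrA -mulrA -expr2 b2.
have := sqr_ge0 (a - b); rewrite sqrrB a2 b2 -natr1; lra.
Qed.

Lemma sum_confidence_radius K T : (1 <= K)%N -> (1 <= T)%N ->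
  4 * \sum_(1 <= n < T) @confidence_radius R K T n <=
  4 * Num.sqrt (2 * T%:R * ln (K%:R * T%:R ^+ 2)).
Proof.
case: T => // T K1 _; rewrite ler_pM2l// /confidence_radius.
set L := ln _.
have L0 : 0 <= L.
  rewrite /L ln_ge0// -natrX -natrM ler1n muln_gt0 K1 expn_gt0//.
(* Each term is [sqrt (L / 2) / sqrt n]. The horizon is now [T.+1], so the sum has [T] terms; the
   squared bound is [2 T L], at most [2 (T + 1) L]. *)
under eq_bigr do rewrite invfM mulrA sqrtrM ?divr_ge0// sqrtrV//.
rewrite -mulr_sumr.
apply: (le_trans (ler_wpM2l (sqrtr_ge0 _) (sum_sqrt_inv T))).
rewrite -ler_sqr ?nnegrE ?mulr_ge0 ?sqrtr_ge0// !exprMn !sqr_sqrtr ?mulr_ge0 ?divr_ge0//.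
rewrite -(natr1 T) mulrDr mulr1 mulrDl.
by rewrite [leLHS](_ : _ = 2 * T%:R * L) ?lerDl ?mulr_ge0//; field.
Qed.

End radius_sum.

(** * Measurability and expected reward of the played arm *)

Section regret.
Context {R : realType} {K T : nat}.
Context d (Omega : measurableType d) (P : probability Omega R)
  (nu : probability (reward_vector R K) R) (X : nat -> {RV P >-> reward_vector R K}).
Context (S : Omega -> nat -> {set 'I_K}) (muhat : Omega -> nat -> 'I_K -> R)
  (m I : Omega -> nat -> 'I_K).
Hypothesis bandit : stochastic_bandit nu X.
Hypothesis run : forall w,
  ELIM_run T (fun t i => tnth (X t w) i) (S w) (muhat w) (m w) (I w).

Let indep : mutually_independent [set t | (1 <= t)%N] X.
Proof. by case: bandit. Qed.

Let distr t : (1 <= t)%N -> forall B, measurable B -> distribution P (X t) B = nu B.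
Proof. by case: bandit => _ /(_ t). Qed.

(** By [ELIM_survivor], survival in a round is a finite combination of conditions on averages over
    strictly earlier rounds; hence [n] rounds determine [S w n.+1]. *)
Lemma measurable_survivor n s i : (s <= n.+1)%N -> (s <= T)%N ->
  @measurable _ (history X n) [set w | i \in S w s].
Proof.
elim: s i => [|s IH] i sn sT.
  rewrite (_ : [set _ | _] = setT); first exact: measurableT.
  by apply/seteqP; split => // w _ /=; have [-> _ _] := run w; rewrite inE.
have mavg j : measurable_fun [set: history X n]
    (fun w : history X n => average (fun t i => tnth (X t w) i) s j).
  apply: (@measurable_empirical_mean _ _ _ _ _ _ X (fun y => tnth y j)) => //.
  exact: measurable_tnth.
have mle j : @measurable _ (history X n)
    [set w | ((average (fun t i => tnth (X t w) i) s j -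
               average (fun t i => tnth (X t w) i) s i)%:E <= 2%:E * rho R K T s.+1)%E].
  have mB : measurable_fun [set: history X n] (fun w : history X n =>
      (average (fun t i => tnth (X t w) i) s j - average (fun t i => tnth (X t w) i) s i)%:E).
    by apply/measurable_EFinP; exact: measurable_funB.
  have := emeasurable_fun_infty_c measurableT mB (2%:E * rho R K T s.+1)%E.
  by rewrite setTI.
rewrite (_ : [set _ | _] = [set w | i \in S w s] `&` \bigcap_(j in [set: 'I_K])
    (~` [set w | j \in S w s] `|`
    [set w | ((average (fun t i => tnth (X t w) i) s j -
               average (fun t i => tnth (X t w) i) s i)%:E <= 2%:E * rho R K T s.+1)%E])).
  apply: (@measurableI _ (history X n)); first exact: IH (ltnW _) (ltnW _).
  apply: (@fin_bigcap_measurable _ (history X n)) => // j _.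
  apply: (@measurableU _ (history X n)) => //.
  apply: (@measurableC _ (history X n)); exact: IH (ltnW _) (ltnW _).
apply/seteqP; split => [w /(ELIM_survivor (run w) _ sT)[iS le_i]|w [iS le_i]].
  split => // j _; have [jS|jS] := boolP (j \in S w s); first by right; exact: le_i.
  by left => /= jS'; rewrite jS' in jS.
apply/(ELIM_survivor (run w) _ sT); split=> // j jS.
by case: (le_i j Logic.I) => // /(_ jS).
Qed.

Lemma measurable_played n i : (n < T)%N ->
  @measurable _ (history X n) [set w | I w n.+1 = i].
Proof.
move=> nT; have mS j := @measurable_survivor n n.+1 j (leqnn _) nT.
rewrite (_ : [set _ | _] = [set w | i \in S w n.+1] `&`
    \bigcap_(j in [set j : 'I_K | (j < i)%N]) ~` [set w | j \in S w n.+1]).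
  apply: (@measurableI _ (history X n)) => //.
  apply: (@fin_bigcap_measurable _ (history X n)) => // j _.
  exact: (@measurableC _ (history X n)).
apply/seteqP; split => [w /= /eqP|w [/= iS imin]].
  rewrite (ELIM_played_eq (run w))// => /andP[iS /forallP imin]; split => // j /= ji.
  by apply/negP; exact: (implyP (imin j)).
apply/eqP; rewrite (ELIM_played_eq (run w))// iS; apply/forallP => j.
by apply/implyP => /imin /negP.
Qed.

Let played_measurable n i : (n < T)%N -> measurable [set w | I w n.+1 = i].
Proof. by move=> nT; exact: (history_measurable (measurable_played i nT)). Qed.

(** Splitting along the value of the played arm reduces questions about a random index to fixed
    arms. *)
Let played_sum n (f : 'I_K -> Omega -> R) w :
  f (I w n.+1) w = \sum_(i < K) \1_[set w | I w n.+1 = i] w * f i w.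
Proof.
rewrite (bigD1 (I w n.+1))//= indicE mem_set// mul1r big1 ?addr0// => i /eqP iI.
by rewrite indicE memNset ?mul0r//= => /esym.
Qed.

Lemma measurable_played_fun n (f : 'I_K -> Omega -> R) : (n < T)%N ->
  (forall i, measurable_fun setT (f i)) ->
  measurable_fun setT (fun w => f (I w n.+1) w).
Proof.
move=> nT mf; under eq_fun do rewrite played_sum.
apply: measurable_sum => i; apply: measurable_funM => //.
exact: (measurable_indic (played_measurable _ _)).
Qed.

(** The event that arm [i] is played in round [n.+1] belongs to the history, so it is independent of
    that round's rewards; both integrals equal the same sum over [i]. *)
Lemma ge0_integral_played n (phi : 'I_K -> reward_vector R K -> R) (mu : 'I_K -> R) :
  (n < T)%N -> (forall i, measurable_fun setT (phi i)) -> (forall i y, 0 <= phi i y) ->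
  (forall i, \int[nu]_y (phi i y)%:E = (mu i)%:E)%E ->
  (\int[P]_w (phi (I w n.+1) (X n.+1 w))%:E = \int[P]_w (mu (I w n.+1))%:E)%E.
Proof.
move=> nT mphi phi0 phimu.
have mu0 i : 0 <= mu i.
  by rewrite -lee_fin -phimu integral_ge0// => y _; rewrite lee_fin.
pose A i := [set w | I w n.+1 = i].
have hA i : @measurable _ (history X n) (A i) by exact: measurable_played.
have mA i : measurable (A i) by exact: played_measurable.
have mind i : measurable_fun [set: Omega] (fun w => (\1_(A i) w : R)%:E).
  by apply/measurable_EFinP; exact: measurable_indic.
have ind0 i w : (0 <= (\1_(A i) w : R)%:E)%E by rewrite lee_fin.
transitivity (\sum_(i < K) P (A i) * (mu i)%:E)%E.
  under eq_integral do rewrite (played_sum n (fun i w => phi i (X n.+1 w))) -sumEFin.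
  rewrite ge0_integral_sum//=; last 2 first.
  - move=> i; apply/measurable_EFinP/measurable_funM; first exact: (measurable_indic (mA i)).
    exact: (measurableT_comp (mphi i)).
  - by move=> i w _; rewrite lee_fin mulr_ge0.
  apply: eq_bigr => i _; under eq_integral do rewrite EFinM.
  have mind_hist : measurable_fun [set: history X n] (fun w : history X n => (\1_(A i) w : R)%:E).
    by apply/measurable_EFinP; exact: (measurable_indic (hA i)).
  have mphiE : measurable_fun [set: reward_vector R K] (fun y => (phi i y)%:E).
    exact/measurable_EFinP.
  have phiE0 y : (0 <= (phi i y)%:E)%E by rewrite lee_fin.
  rewrite (ge0_integral_history indep mind_hist mphiE)//.
  by rewrite integral_indic// setIT (ge0_integral_identically distr _ mphiE)// phimu.
under [RHS]eq_integral do rewrite (played_sum n (fun i _ => mu i)) -sumEFin.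
rewrite ge0_integral_sum//=; last 2 first.
- by move=> i; apply/measurable_EFinP/measurable_funM => //; exact: (measurable_indic (mA i)).
- by move=> i w _; rewrite lee_fin mulr_ge0.
apply: eq_bigr => i _; under [RHS]eq_integral do rewrite EFinM.
by rewrite (ge0_integralZr _ measurableT (mind i)) ?lee_fin// (integral_indic _ _ (mA i))// setIT.
Qed.

End regret.

(** * Reduction to rewards bounded everywhere *)

Section clip.
Context {R : realType}.

(* Rewards lie in the unit interval only almost surely; clipping makes this hold
   everywhere without changing expectations. *)
Definition clip (r : R) : R := Num.max 0 (Num.min 1 r).

Lemma clip01 r : 0 <= clip r <= 1.
Proof. by rewrite /clip le_max lexx/= ge_max ler01 ge_min lexx. Qed.

Lemma clip_id r : 0 <= r <= 1 -> clip r = r.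
Proof. by move=> /andP[r0 r1]; rewrite /clip min_r// max_r. Qed.

Lemma measurable_clip : measurable_fun [set: R] clip.
Proof. by apply: measurable_maxr => //; exact: measurable_minr. Qed.

Lemma measurable_unit_cube K : measurable (@unit_cube R K).
Proof.
rewrite (_ : @unit_cube R K = \bigcap_(i in [set: 'I_K])
    ((fun x : reward_vector R K => tnth x i) @^-1` [set` `[0, 1]%R])).
  apply: fin_bigcap_measurable => // i _; rewrite -[X in measurable X]setTI.
  by apply: measurable_tnth => //; exact: measurable_itv.
by apply/seteqP; split => [x x01 i _ /=|x x01 i]; [|have := x01 i Logic.I];
  rewrite /= in_itv/=.
Qed.

Lemma unit_cubeC_null K (nu : probability (reward_vector R K) R) :
  nu (@unit_cube R K) = 1%E -> nu (~` @unit_cube R K) = 0%E.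
Proof.
by move=> nu1; have := probability_setC nu (@measurable_unit_cube K); rewrite nu1 subee.
Qed.

(** A countable union, over the rounds, of null events. *)
Lemma ae_unit_cube d (Omega : measurableType d) (P : probability Omega R) K
    (nu : probability (reward_vector R K) R) (X : nat -> {RV P >-> reward_vector R K}) :
  stochastic_bandit nu X ->
  {ae P, forall w, forall t, (1 <= t)%N -> @unit_cube R K (X t w)}.
Proof.
move=> [nu1 distr _].
have mC : measurable (~` @unit_cube R K) by apply: measurableC; exact: (@measurable_unit_cube K).
have nuC := unit_cubeC_null nu1.
have neg t : P.-negligible (X t.+1 @^-1` (~` @unit_cube R K)).
  have mN : measurable (X t.+1 @^-1` (~` @unit_cube R K)).
    by rewrite -[X in measurable X]setTI; exact: measurable_funP.
  by apply: (proj2 (negligibleP _ mN)); rewrite -nuC -(distr t.+1).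
apply: negligibleS (negligible_bigcup neg) => w /=.
apply: contra_notP => H t t1; apply: contrapT => Xt; apply: H.
by case: t t1 Xt => // t _ Xt; exists t.
Qed.

End clip.

(** * Calibration of the failure probability *)

Section failure_probability.
Context {R : realType}.

Lemma integrable_unit_interval d (Omega : measurableType d) (P : probability Omega R)
    (f : Omega -> R) :
  measurable_fun setT f -> (forall w, 0 <= f w <= 1) -> P.-integrable setT (EFin \o f).
Proof.
move=> mf f01; apply: measurable_bounded_integrable => //.
  by rewrite ltey_eq fin_num_measure.
exists 1; split => // M M1 w _ /=; have /andP[f0 f1] := f01 w.
by rewrite ger0_norm// (le_trans f1)// ltW.
Qed.

(** The radius is chosen to make the exponent [ln (K T^2)]. As [K T^2 >= 1], this logarithm is
    non-negative and squaring undoes the root. *)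
Lemma expR_confidence_radius K T n : (1 <= K)%N -> (1 <= T)%N -> (0 < n)%N ->
  expR (- (2 * n%:R * @confidence_radius R K T n ^+ 2)) = (K%:R * T%:R ^+ 2)^-1.
Proof.
move=> K1 T1 n0.
have KT : 1 <= K%:R * T%:R ^+ 2 :> R.
  by rewrite -natrX -natrM ler1n muln_gt0 K1 expn_gt0 T1.
rewrite /confidence_radius sqr_sqrtr; last by rewrite divr_ge0 ?ln_ge0// mulr_ge0.
rewrite mulrC divfK; last by rewrite mulf_neq0// pnatr_eq0 -lt0n.
by rewrite expRN lnK// posrE (lt_le_trans ltr01).
Qed.

End failure_probability.

(** * The regret bound *)

Theorem theorem1 (R : realType) (K T : nat) (K_ge1 : (1 <= K)%N)
    (T_ge1 : (1 <= T)%N)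
    (d : measure_display) (Omega : measurableType d) (P : probability Omega R)
    (nu : probability (reward_vector R K) R)
    (X : nat -> {RV P >-> reward_vector R K})
    (bandit : stochastic_bandit nu X)
    (istar : 'I_K) (istar_best : best_arm nu istar)
    (S : Omega -> nat -> {set 'I_K}) (muhat : Omega -> nat -> 'I_K -> R)
    (m I : Omega -> nat -> 'I_K)
    (run : forall w : Omega,
       ELIM_run T (fun t i => tnth (X t w) i) (S w) (muhat w) (m w) (I w)) :
  (pseudo_regret T X istar I
     <= (4 * Num.sqrt (2 * T%:R * ln (K%:R * T%:R ^+ 2)) + 3)%:E)%E.
Proof.
have [nu1 distr indep] := bandit.
pose phi (i : 'I_K) (y : reward_vector R K) := clip (tnth y i).
have phi01 i y : 0 <= phi i y <= 1 by exact: clip01.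
have mtnth i : measurable_fun setT (fun y : reward_vector R K => tnth y i).
  exact: measurable_tnth.
have mphi i : measurable_fun setT (phi i).
  exact: (measurableT_comp (@measurable_clip R) (mtnth i)).
pose mu i := fine (\int[nu]_y (phi i y)%:E)%E.
have phimu i : (\int[nu]_y (phi i y)%:E = (mu i)%:E)%E.
  by rewrite /mu fineK//; apply: integrable_fin_num => //; exact: integrable_unit_interval.
have mu01 i : 0 <= mu i <= 1 by exact: (mean01 (mphi i) (phi01 i) (phimu i)).
(* Clipping does not change the means, so [istar] is also best for the clipped rewards. *)
have mu_best i : mu i <= mu istar.
  have mean j : mean_reward nu j = (mu j)%:E.
    rewrite -phimu /mean_reward unlock; apply: ae_eq_integral => //.
    - apply/measurable_EFinP; exact: (mtnth j).
    - apply/measurable_EFinP; exact: (mphi j).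
    have mC := measurableC (@measurable_unit_cube R K).
    exists (~` @unit_cube R K); split=> //; first exact: unit_cubeC_null.
    move=> y /=; apply: contra_not => y01 _.
    by rewrite /phi clip_id.
  by have := istar_best i; rewrite !mean lee_fin.
have aeX := ae_unit_cube bandit.
(* [F] is the regret in clipped rewards and [G] the regret in means; index [n] stands for round
   [n.+1]. *)
pose F w := \sum_(n < T) (phi istar (X n.+1 w) - phi (I w n.+1) (X n.+1 w)).
pose G w := \sum_(n < T) (mu istar - mu (I w n.+1)).
have mX i n : measurable_fun setT (fun w => phi i (X n w)).
  exact: (measurableT_comp (mphi i)).
have mphiI (n : 'I_T) : measurable_fun setT (fun w => phi (I w n.+1) (X n.+1 w)).
  exact: (measurable_played_fun run (ltn_ord n) (fun i => mX i n.+1)).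
have mmuI (n : 'I_T) : measurable_fun setT (fun w => mu (I w n.+1)).
  exact: (measurable_played_fun run (f := fun i _ => mu i) (ltn_ord n)).
have mF : measurable_fun setT F.
  by apply: measurable_sum => n; exact: measurable_funB.
have mG : measurable_fun setT G.
  by apply: measurable_sum => n; exact: measurable_funB.
have -> : pseudo_regret T X istar I = (\int[P]_w (F w)%:E)%E.
  rewrite /pseudo_regret unlock; apply: ae_eq_integral => //.
  - apply/measurable_EFinP.
    under eq_fun do rewrite big_add1 big_mkord.
    apply: measurable_sum => n; apply: measurable_funB.
      exact: (measurableT_comp (mtnth istar)).
    apply: (measurable_played_fun run (f := fun i w => tnth (X n.+1 w) i) (ltn_ord n)) => i.
    exact: (measurableT_comp (mtnth i)).
  - exact/measurable_EFinP.
  apply: filterS aeX => w cube _; congr (_%:E).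
  rewrite big_add1 big_mkord; apply: eq_bigr => n _.
  by rewrite /phi !clip_id//; exact: cube.
have -> : (\int[P]_w (F w)%:E = \int[P]_w (G w)%:E)%E.
  have intphiI (n : 'I_T) : P.-integrable setT (EFin \o (fun w => phi (I w n.+1) (X n.+1 w))).
    exact: integrable_unit_interval.
  have intmuI (n : 'I_T) : P.-integrable setT (EFin \o (fun w => mu (I w n.+1))).
    exact: integrable_unit_interval.
  have intphi (n : 'I_T) : P.-integrable setT (EFin \o (fun w => phi istar (X n.+1 w))).
    exact: integrable_unit_interval.
  have intmu : P.-integrable setT (EFin \o cst (mu istar)).
    exact: finite_measure_integrable_cst.
  rewrite /F /G; under eq_integral do rewrite -sumEFin.
  under [RHS]eq_integral do rewrite -sumEFin.
  rewrite !integral_sum//; last 2 first.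
  - by move=> n; exact: (integrableB measurableT intmu (intmuI n)).
  - by move=> n; exact: (integrableB measurableT (intphi n) (intphiI n)).
  apply: eq_bigr => n _.
  under eq_integral do rewrite EFinB.
  under [RHS]eq_integral do rewrite EFinB.
  rewrite (integralB_EFin measurableT (intphi n) (intphiI n)).
  rewrite (integralB_EFin measurableT intmu (intmuI n)).
  rewrite (ge0_integral_played bandit run (ltn_ord n) mphi _ phimu); last first.
    by move=> i y; case/andP: (phi01 i y).
  congr (_ - _)%E; rewrite probability_integral_cst -phimu.
  have mphiE : measurable_fun setT (fun y => (phi istar y)%:E) by exact/measurable_EFinP.
  rewrite (ge0_integral_identically distr _ mphiE)// => y.
  by rewrite lee_fin; case/andP: (phi01 istar y).
pose r n : R := @confidence_radius R K T n.
have r0 n : 0 <= r n by exact: sqrtr_ge0.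
(* The failure events. With no completed round, [n = 0], the event is empty. *)
pose B (n : 'I_T) i : set Omega :=
  [set w | (0 < n)%N /\ r n < `|empirical_mean X (phi i) n w - mu i|].
have mB n i : measurable (B n i).
  have [n0|n0] := posnP n.
    rewrite (_ : B n i = set0)//; apply/seteqP; split => // w [].
    by rewrite n0.
  rewrite (_ : B n i = [set w | r n < `|empirical_mean X (phi i) n w - mu i|]).
    exact: measurable_deviation.
  by apply/seteqP; split => [w []|w].
have PB n i : (P (B n i) <= (2 * (K%:R * T%:R ^+ 2)^-1)%:E)%E.
  have [n0|n0] := posnP n.
    rewrite (_ : B n i = set0) ?measure0 ?lee_fin ?mulr_ge0 ?invr_ge0 ?mulr_ge0//.
    by apply/seteqP; split => // w []; rewrite n0.
  have := hoeffding indep distr (mphi i) (phi01 i) (phimu i) n0 (r0 n).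
  rewrite expR_confidence_radius//; apply: le_trans; apply: le_measure; rewrite ?inE//.
    exact: measurable_deviation.
  by move=> w [].
(* The bound without failure: [1] for round 1 and [4 * r n] for round [n.+1]. *)
pose c : R := 1 + 4 * \sum_(1 <= n < T) r n.
have c0 : 0 <= c.
  by rewrite /c addr_ge0// mulr_ge0// sumr_ge0.
(* Counting every deviation turns the union bound into linearity of the integral. *)
pose H w := c + T%:R * \sum_(n < T) \sum_(i < K) (\1_(B n i) w : R).
have ind0 n i w : 0 <= (\1_(B n i) w : R) by [].
have mind n i : measurable_fun setT (\1_(B n i) : Omega -> R).
  exact: measurable_indic.
have mind2 (n : 'I_T) : measurable_fun setT (fun w => \sum_(i < K) (\1_(B n i) w : R)).
  by apply: measurable_sum => i.
have mH0 : measurable_fun setT (fun w => \sum_(n < T) \sum_(i < K) (\1_(B n i) w : R)).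
  by apply: measurable_sum => n.
have G_le_H : {ae P, forall w, setT w -> ((G w)%:E <= (H w)%:E)%E}.
  apply: filterS aeX => w cube _; rewrite lee_fin /H.
  have gap1 i : mu istar - mu i <= 1.
    by have := mu01 istar; have := mu01 i; lra.
  (* Under a failure, [G] is at most [T] while the double sum in [H] is at least [1]. *)
  have [[n [i Bw]]|nB] := pselect (exists n i, B n i w).
    apply: (@le_trans _ _ T%:R).
      rewrite -[T in leRHS]card_ord -sumr_const; apply: ler_sum => k _.
      exact: gap1.
    apply: (@le_trans _ _ (T%:R * \sum_(n < T) \sum_(i < K) (\1_(B n i) w : R))); last first.
      by rewrite lerDr.
    rewrite -[leLHS]mulr1 ler_wpM2l//.
    rewrite (bigD1 n)//= (bigD1 i)//= indicE mem_set// -addrA lerDl.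
    by rewrite addr_ge0// sumr_ge0// => k _; exact: sumr_ge0.
  have good n i : (0 < n < T)%N -> `|average (fun t i => tnth (X t w) i) n i - mu i| <= r n.
    move=> /andP[n0 nT]; rewrite leNgt; apply/negP => dev; apply: nB.
    exists (Ordinal nT), i; split => //=.
    rewrite /empirical_mean (eq_big_nat _ _ (F2 := fun t => tnth (X t w) i))// => t /andP[t1 _].
    by rewrite /phi clip_id//; exact: cube.
  apply: (@le_trans _ _ c); last first.
    by rewrite lerDl mulr_ge0// sumr_ge0// => n _; exact: sumr_ge0.
  (* The term [n = 0] is split off, since [ELIM_gap] needs at least one completed round. *)
  rewrite /G -(big_mkord xpredT (fun n => mu istar - mu (I w n.+1))) big_ltn// /c mulr_sumr.
  apply: lerD => //; rewrite [leLHS]big_nat_cond [leRHS]big_nat_cond.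
  apply: ler_sum => n /andP[nT _].
  exact: (ELIM_gap (run w) mu_best good nT).
apply: (@le_trans _ _ (\int[P]_w (H w)%:E)%E).
  apply: ae_ge0_le_integral => //.
  - by move=> w _; rewrite lee_fin sumr_ge0// => n _; rewrite subr_ge0.
  - exact/measurable_EFinP.
  - move=> w _; rewrite lee_fin addr_ge0// mulr_ge0// sumr_ge0// => n _.
    exact: sumr_ge0.
  - by apply/measurable_EFinP/measurable_funD => //; exact: measurable_funM.
rewrite /H; under eq_integral do rewrite EFinD EFinM.
rewrite ge0_integralD//; last 2 first.
- by move=> w _; rewrite mule_ge0// lee_fin// sumr_ge0// => n _; exact: sumr_ge0.
- apply: emeasurable_funM => //; exact/measurable_EFinP.
rewrite probability_integral_cst ge0_integralZl_EFin//; last 2 first.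
- by move=> w _; rewrite lee_fin// sumr_ge0// => n _; exact: sumr_ge0.
- exact/measurable_EFinP.
under eq_integral do rewrite -sumEFin.
rewrite ge0_integral_sum//; last 2 first.
- by move=> n; exact/measurable_EFinP.
- by move=> n w _; rewrite lee_fin sumr_ge0.
have PBn (n : 'I_T) : (\int[P]_w (\sum_(i < K) (\1_(B n i) w : R))%:E <=
    (K%:R * (2 * (K%:R * T%:R ^+ 2)^-1))%:E)%E.
  under eq_integral do rewrite -sumEFin.
  rewrite ge0_integral_sum//; last by move=> i; apply/measurable_EFinP; exact: mind.
  under eq_bigr do rewrite integral_indic// setIT.
  apply: (@le_trans _ _ (\sum_(i < K) (2 * (K%:R * T%:R ^+ 2)^-1)%:E)%E).
    by apply: lee_sum => i _; exact: PB.
  by rewrite sumEFin lee_fin sumr_const card_ord -[leLHS]mulr_natl.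
(* There are [T * K] failure events of probability at most [2 / (K T^2)], each weighted by [T]: they
   add [2] to the [1] contained in [c]. *)
apply: (@le_trans _ _ (c%:E + T%:R%:E * (T%:R * (K%:R * (2 * (K%:R * T%:R ^+ 2)^-1)))%:E)%E).
  apply: leeD => //; apply: lee_wpmul2l; first by rewrite lee_fin.
  apply: (@le_trans _ _
      (\sum_(n < T) (K%:R * (2 * (K%:R * T%:R ^+ 2)^-1))%:E)%E).
    by apply: lee_sum => n _; exact: PBn.
  by rewrite sumEFin lee_fin sumr_const card_ord -[leLHS]mulr_natl.
rewrite -EFinM -EFinD lee_fin.
rewrite (_ : T%:R * _ = 2); last first.
  by field; rewrite !pnatr_eq0 -!lt0n K_ge1 T_ge1.
by have := @sum_confidence_radius R K T K_ge1 T_ge1; rewrite /c /r; lra.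
Qed.
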